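(* Let $n\ge 3$ be an integer, $0<m<\frac{n-2}{n}$, $\alpha,\beta\in\mathbb{R}$, $\gamma>0$ with $\gamma\ne\frac{2}{1-m}$, and $\eta>0$. Suppose there exists a radially symmetric solution $f$ of $$\Delta (f^m/m)+\alpha f+\beta x\cdot\nabla f=0,\quad f>0,\quad\text{ in }\mathbb{R}^n\setminus\{0\}$$ which satisfies $$\lim_{|x|\to 0}|x|^{\gamma}f(x)=\eta.$$ Then either (i) $\alpha=\beta=0$ holds, or (ii) $\alpha\in\mathbb{R}$ and $\beta\ne 0$, and $$\gamma=\frac{\alpha}{\beta}\quad\text{ and }\quad\gamma>\frac{2}{1-m}$$ holds.
   Context: ''Solution'' means a classical (twice continuously differentiable) positive function satisfying the equation pointwise on $\mathbb{R}^n\setminus\{0\}$. Radially symmetric means that $f(x)$ depends only on $|x|$. *)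

(* Defs.v *)
From HB Require Import structures.
From mathcomp Require Import all_boot all_order all_algebra.
From mathcomp Require Import all_classical all_reals all_analysis.
Set Implicit Arguments.
Unset Strict Implicit.
Unset Printing Implicit Defensive.
Import Order.TTheory GRing.Theory Num.Theory.
Import numFieldNormedType.Exports.
Local Open Scope classical_set_scope.
Local Open Scope ring_scope.

Section EuclideanSpace.
Context {R : realType} {n : nat}.
Implicit Types (x y : 'rV[R]_n) (i j : 'I_n) (f : 'rV[R]_n -> R).

Definition dotmul x y : R := \sum_(i < n) x 0 i * y 0 i.

(* The library norm `|x| on 'rV[R]_n is the sup norm: same topology as enorm,
   but not the same radial functions. *)
Definition enorm x : R := Num.sqrt (dotmul x x).

Definition partial i f : 'rV[R]_n -> R := fun x => 'D_(delta_mx 0 i) f x.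

Definition grad f x : 'rV[R]_n := \row_i partial i f x.

Definition laplacian f x : R := \sum_(i < n) partial i (partial i f) x.

Definition C1_on (U : set 'rV[R]_n) f : Prop :=
  forall i x, U x ->
    derivable f x (delta_mx 0 i) /\ {for x, continuous (partial i f)}.

Definition C2_on (U : set 'rV[R]_n) f : Prop :=
  C1_on U f /\ forall i, C1_on U (partial i f).

Definition punctured : set 'rV[R]_n := [set x | x != 0].

Definition radially_symmetric f : Prop :=
  forall x y, punctured x -> punctured y -> enorm x = enorm y -> f x = f y.

(* The value of f at 0 is irrelevant: every condition below is local on the
   open set [punctured]. *)
Definition solution (m alpha beta : R) f : Prop :=
  [/\ C2_on punctured f,
      forall x, punctured x -> 0 < f x
    & forall x, punctured x ->
        laplacian (fun y => f y `^ m / m) x + alpha * f x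
          + beta * dotmul x (grad f x) = 0].

End EuclideanSpace.

Arguments punctured {R n}.

(* Main.v *)
Require Import Defs.
From mathcomp Require Import all_boot all_order all_algebra.
From mathcomp Require Import all_classical all_reals all_analysis.
From mathcomp Require Import ring lra.
Import Order.TTheory GRing.Theory Num.Theory.
Import numFieldNormedType.Exports.
Local Open Scope classical_set_scope.
Local Open Scope ring_scope.

Set Implicit Arguments.
Unset Strict Implicit.
Unset Printing Implicit Defensive.

(** Near the origin f behaves like eta |x|^(-gamma), so f^m / m contributes
terms of size |x|^(-gamma m - 2) to the equation, and alpha f + beta x . grad f
contributes terms of size |x|^(-gamma). The sign of
k = 2 - gamma (1 - m) decides which of them is larger as x -> 0, and the leading
coefficient of the larger one has to vanish.
 - If k > 0, diffusion wins and gamma m (gamma m - (n - 2)) = 0. Then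
   gamma m = n - 2, so k = n - gamma > 0 gives gamma < n and n - 2 < n m, which
   contradicts m < (n - 2) / n.
 - If k < 0, the first-order part wins and alpha = beta gamma, which is the
   announced alternative.

The difficulty is that only the convergence of |x|^gamma f is known, and nothing
about its derivatives. Write t = ln |x|, c = gamma m, v = |x|^gamma f and
z = v^m / m. The equation for a radial f becomes, for z as a function of t on
the whole line (lemma rescaled_ode),
  z'' + (n - 2 - 2c) z' + c (c - (n - 2)) z
     + e^(k t) ((alpha - beta gamma) v + beta v^(1-m) z') = 0,
with v -> eta and z -> eta^m / m as t -> -oo. Up to multiplication by e^(-k t)
when k < 0, this is an equation p z'' + q z' + s = 0 in which p >= 0, and p, q,
s, z all converge at -oo. In such an equation s must tend to 0 (lemma
limit_zero_order_term). Indeed, a convergent z can be touched from above, at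
points t arbitrarily close to -oo, by parabolas that are as flat as desired. At
a contact point z' is almost 0 and z'' is almost nonpositive, hence s is almost
nonnegative; the same argument for -z gives the other sign. This replaces
integration against test functions or a blow-up argument.

The passage to the variable t uses that a radial C^2 function is a C^2 function
of t = ln (x . x) / 2, obtained by restricting it to a half-axis; its Laplacian
and Euler derivative are then computed one coordinate line at a time. *)

(** * Contact with flat parabolas and the limit equation *)

(** The second-order necessary condition only asks for h1 to be differentiable at
c itself: if h2 > 0 then h1 > 0 just to the right of c, and the mean value
theorem puts a larger value of h there. *)
Lemma derivative_at_interior_max (R : realType) (h h1 : R -> R) (a b c h2 : R) :
  (forall t : R, is_derive t 1 h (h1 t)) -> is_derive c 1 h1 h2 ->
  a < c < b -> (forall t, a < t < b -> h t <= h c) ->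
  h1 c = 0 /\ h2 <= 0.
Proof.
move=> dh dh1 cab hmax.
have h1c : h1 c = 0.
  have d0 : is_derive c 1 h 0.
    apply: (@derive1_at_max _ h a b c).
    - by case/andP: cab => ac cb; rewrite (ltW (lt_trans ac cb)).
    - by move=> t _; have [] := dh t.
    - by rewrite in_itv.
    - by move=> t; rewrite in_itv; exact: hmax.
  by have [_ <-] := dh c; have [_ ->] := d0.
split=> //; rewrite leNgt; apply/negP => h2_gt0.
have slope : (fun e => e^-1 *: (h1 (e *: 1 + c) - h1 c)) @ 0^' --> h2.
  by have [dr <-] := dh1; exact: dr.
have [d /= d0 hd] : \forall e \near 0^', 0 < e^-1 *: (h1 (e *: 1 + c) - h1 c).
  exact: (cvgr_gt _ slope).
pose e := Num.min d (b - c) / 2.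
have m0 : 0 < Num.min d (b - c).
  by rewrite lt_min d0 subr_gt0; case/andP: cab.
have e0 : 0 < e by rewrite divr_gt0.
have [ed ebc] : e < d /\ e < b - c.
  have : e < Num.min d (b - c) by rewrite ltr_pdivrMr// ltr_pMr ?ltr1n.
  by rewrite lt_min => /andP[].
have hcont : {within `[c, c + e], continuous h}.
  apply: continuous_subspaceT => x; apply: differentiable_continuous.
  by apply/derivable1_diffP; have [] := dh x.
have cce : c < c + e by rewrite ltrDl.
have [x] := MVT cce (fun x _ => dh x) hcont.
rewrite in_itv/= => /andP[cx xe].
have : h (c + e) - h c <= 0.
  rewrite subr_le0; apply: hmax; case/andP: cab => ac cb.
  by rewrite (lt_trans ac) ?ltrDl//= -ltrBrDl.
move=> + E; rewrite E [c + e]addrC addrK pmulr_lle0// leNgt => /negP; apply.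
have : 0 < (x - c)^-1 *: (h1 ((x - c) *: 1 + c) - h1 c).
  apply: hd; last by rewrite subr_eq0 gt_eqF.
  rewrite /= /ball/= sub0r normrN gtr0_norm ?subr_gt0//.
  by apply: lt_trans ed; rewrite ltrBlDl.
rewrite h1c subr0 scaler1 subrK /GRing.scale/= pmulr_rgt0//.
by rewrite invr_gt0 subr_gt0.
Qed.

(** Convergence of z controls z' and z'' nowhere in particular, but it does at
suitable points: on an interval of length 2 where z oscillates by less than
e / 2, subtracting the parabola of curvature e that is centred in the middle
forces an interior maximum. *)
Lemma touching_parabola (R : realType) (z z1 z2 : R -> R) (l e T : R) :
  (forall t : R, is_derive t 1 z (z1 t)) ->
  (forall t : R, is_derive t 1 z1 (z2 t)) ->
  z t @[t --> -oo] --> l -> 0 < e ->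
  exists2 t, t < T & `|z1 t| <= e /\ z2 t <= e.
Proof.
move=> dz dz1 zl e0.
have e80 : 0 < e / 8 by rewrite divr_gt0.
have [M [_ zM]] : \forall t \near -oo, `|l - z t| < e / 8.
  by move/cvgrPdist_lt : zl; exact.
(* The shift by 2 keeps all of [t0 - 1, t0 + 1] strictly below M and T. *)
pose t0 := Num.min M T - 2.
have ltM (t : R) : t <= t0 + 1 -> t < M /\ t < T.
  move=> tt; have : t < Num.min M T by rewrite /t0 in tt; lra.
  by rewrite lt_min => /andP[].
pose q t := (e / 2) * (t - t0) ^+ 2.
pose h t := z t - q t.
have dq (t : R) : is_derive t 1 q (e * (t - t0)).
  rewrite (_ : q = (e / 2) \*: ((id - cst t0) ^+ 2))//.
  apply: is_derive_eq; rewrite /GRing.scale/= !subr0 expr1 /cst !fctE; lra.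
have dlin (t : R) : is_derive t 1 (fun t => e * (t - t0)) e.
  rewrite (_ : (fun t => _) = e \*: (id - cst t0))//.
  by apply: is_derive_eq; rewrite /GRing.scale/= subr0 mulr1.
have dh (t : R) : is_derive t 1 h (z1 t - e * (t - t0)).
  by rewrite (_ : h = z - q)//; exact: is_deriveB.
have dh1 (t : R) : is_derive t 1 (fun t => z1 t - e * (t - t0)) (z2 t - e).
  rewrite (_ : (fun t => _) = z1 - (fun t => e * (t - t0)))//.
  exact: is_deriveB.
have hcont : {within `[t0 - 1, t0 + 1], continuous h}.
  apply: continuous_subspaceT => x; apply: differentiable_continuous.
  by apply/derivable1_diffP; have [] := dh x.
have le_ends : t0 - 1 <= t0 + 1 by lra.
have [c] := EVT_max le_ends hcont.
rewrite in_itv/= => /andP[c1 c2] hmax.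
have zb (t : R) : t <= t0 + 1 -> l - e / 8 < z t < l + e / 8.
  by move=> /ltM[tM _]; have := zM _ tM; rewrite ltr_distlC.
have hc : z t0 <= h c.
  have := hmax t0; rewrite in_itv/= /h /q subrr expr0n/= mulr0 subr0; apply.
  by apply/andP; split; lra.
have zt0 := zb t0 ltac:(lra).
have zc := zb c c2.
(* At the ends of the interval the parabola has height e / 2, more than the
   oscillation of z, so the maximum is interior. *)
have qc : q c < e / 2 by rewrite /h in hc; lra.
have cc : t0 - 1 < c < t0 + 1.
  apply/andP; split; rewrite lt_neqAle ?c1 ?c2 andbT; apply/eqP => E.
    by move: qc; rewrite /q -E (_ : t0 - 1 - t0 = -1) ?sqrrN ?expr1n; lra.
  by move: qc; rewrite /q E (_ : t0 + 1 - t0 = 1) ?expr1n; lra.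
have [|z1c z2c] := derivative_at_interior_max dh (dh1 c) cc.
  by move=> t /andP[t1 t2]; apply: hmax; rewrite in_itv/= !ltW.
exists c; first by have [] := ltM c c2.
split; last by lra.
have -> : z1 c = e * (c - t0) by lra.
rewrite normrM gtr0_norm// ger_pMr// ler_norml.
by apply/andP; split; lra.
Qed.

(** Only an upper bound for z'' is available at the contact points, which is why
p must be nonnegative and why one inequality is obtained at a time. *)
Lemma limit_zero_order_term_ge0 (R : realType) (z z1 z2 p q s : R -> R)
    (l p0 q0 s0 : R) :
  (forall t : R, is_derive t 1 z (z1 t)) ->
  (forall t : R, is_derive t 1 z1 (z2 t)) ->
  (forall t, 0 <= p t) ->
  (forall t, p t * z2 t + q t * z1 t + s t = 0) ->
  z t @[t --> -oo] --> l -> p t @[t --> -oo] --> p0 ->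
  q t @[t --> -oo] --> q0 -> s t @[t --> -oo] --> s0 ->
  0 <= s0.
Proof.
move=> dz dz1 p_ge0 ode zl pl ql sl; rewrite leNgt; apply/negP => s0_lt0.
have [P [_ pP]] := cvgr_lt _ pl (p0 + 1) ltac:(lra).
have [Q [_ qQ]] := cvgr_norm_lt _ ql (`|q0| + 1) ltac:(lra).
have [S [_ sS]] := cvgr_lt _ sl (s0 / 2) ltac:(lra).
pose K := `|p0| + `|q0| + 2.
have K0 : 0 < K by rewrite /K; have := normr_ge0 p0; have := normr_ge0 q0; lra.
(* K bounds p and |q| near -oo. With this e, the terms p z'' and q z' are both
   at most - s0 / 8, so that the left-hand side of the equation is at most
   - s0 / 4 + s0 / 2 = s0 / 4 at a contact point. *)
pose e := - s0 / (8 * K).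
have e0 : 0 < e by rewrite divr_gt0//; lra.
have eK : e * K = - s0 / 8 by rewrite /e; field; rewrite gt_eqF.
have [t tT [z1t z2t]] :=
  @touching_parabola _ _ _ _ _ _ (Num.min P (Num.min Q S)) dz dz1 zl e0.
move: tT; rewrite !lt_min => /and3P[/pP/= pt /qQ/= qt /sS/= st].
have pz : p t * z2 t <= K * e.
  apply: (le_trans (ler_wpM2l (p_ge0 t) z2t)).
  rewrite ler_wpM2r ?ltW//; rewrite /K.
  by have := ler_norm p0; have := normr_ge0 q0; lra.
have qz : q t * z1 t <= K * e.
  apply: (le_trans (ler_norm _)); rewrite normrM ler_pM//.
  by rewrite /K; have := normr_ge0 p0; lra.
by have := ode t; lra.
Qed.

(** This is the asymptotic principle behind the theorem: the leading-order
balance of the equation holds in the limit even though z' and z'' need not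
converge. The coefficient p may tend to 0. *)
Lemma limit_zero_order_term (R : realType) (z z1 z2 p q s : R -> R)
    (l p0 q0 s0 : R) :
  (forall t : R, is_derive t 1 z (z1 t)) ->
  (forall t : R, is_derive t 1 z1 (z2 t)) ->
  (forall t, 0 <= p t) ->
  (forall t, p t * z2 t + q t * z1 t + s t = 0) ->
  z t @[t --> -oo] --> l -> p t @[t --> -oo] --> p0 ->
  q t @[t --> -oo] --> q0 -> s t @[t --> -oo] --> s0 ->
  s0 = 0.
Proof.
move=> dz dz1 p_ge0 ode zl pl ql sl; apply/eqP; rewrite eq_le; apply/andP; split.
  rewrite -oppr_ge0.
  apply: (@limit_zero_order_term_ge0 _ (- z) (- z1) (- z2) p q (- s)
    (- l) p0 q0) => //; last 2 first.
  - exact: cvgN.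
  - exact: cvgN.
  - by move=> t; rewrite !fctE; have := ode t; lra.
exact: (@limit_zero_order_term_ge0 _ z z1 z2 p q s l p0 q0).
Qed.

(** * Radial functions in the logarithmic variable *)

Lemma dotmul_gt0 (R : realType) (n : nat) (x : 'rV[R]_n) :
  x != 0 -> 0 < dotmul x x.
Proof.
move=> x0; have sq_ge0 i : 0 <= x 0 i * x 0 i by rewrite -expr2 sqr_ge0.
rewrite lt_neqAle sumr_ge0 ?andbT; last by move=> i _; exact: sq_ge0.
apply: contra x0 => /eqP/esym d0; apply/eqP/rowP => i; rewrite mxE.
have := psumr_eq0P (fun i _ => sq_ge0 i) d0 (i := i) isT.
by move/eqP; rewrite mulf_eq0 orbb => /eqP.
Qed.

Lemma dotmul_axis (R : realType) (n : nat) (x : 'rV[R]_n) (i : 'I_n) (s : R) :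
  let y := x + s *: delta_mx 0 i in
  dotmul y y = dotmul x x + (2 * x 0 i) * s + s ^+ 2.
Proof.
rewrite /dotmul /= [in LHS](bigD1 i)//= [in RHS](bigD1 i)//=.
rewrite (eq_bigr (fun j => x 0 j * x 0 j)); last first.
  move=> j /negbTE ji; rewrite !mxE eqxx ji/= mulr0 addr0//.
by rewrite !mxE !eqxx/=; ring.
Qed.

(** The two difference quotients differ only in how the point is parametrized;
this is what identifies directional derivatives with derivatives of one real
variable. *)
Lemma line_quotient (R : realType) (n : nat) (f : 'rV[R]_n -> R)
    (x v : 'rV[R]_n) (s : R) :
  (fun h => h^-1 *: (f (h *: v + (x + s *: v)) - f (x + s *: v))) =
  (fun h : R => h^-1 *: (f (x + (h *: 1 + s) *: v) - f (x + s *: v))).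
Proof.
apply/funext => h; congr (_ *: (f _ - _)).
by rewrite scaler1 scalerDl addrCA.
Qed.

Lemma is_derive_line (R : realType) (n : nat) (f : 'rV[R]_n -> R)
    (x v : 'rV[R]_n) (s l : R) :
  is_derive s 1 (fun u : R => f (x + u *: v)) l <->
  is_derive (x + s *: v) v f l.
Proof.
by split=> -[df <-]; split; rewrite /derivable /derive/= ?line_quotient//;
   rewrite -line_quotient.
Qed.

Lemma is_derive_half_ln (R : realType) (q : R -> R) (s q1 : R) :
  0 < q s -> is_derive s 1 q q1 ->
  is_derive s 1 (fun u => ln (q u) / 2) (q1 / q s / 2).
Proof.
move=> q0 dq.
rewrite (_ : (fun u => _) = 2^-1 \*: (@ln R \o q)); last first.
  by apply/funext => u; rewrite /= mulrC.
have dl := is_derive1_ln q0.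
by apply: is_derive_eq; rewrite /GRing.scale/=; ring.
Qed.

Lemma is_derive_dotmul_axis (R : realType) (n : nat) (x : 'rV[R]_n) (i : 'I_n)
    (s : R) :
  is_derive s 1 (fun u : R => dotmul (x + u *: delta_mx 0 i) (x + u *: delta_mx 0 i))
    (2 * (x 0 i + s)).
Proof.
rewrite (_ : (fun u => _) =
    cst (dotmul x x) + (2 * x 0 i) \*: id + (id : R -> R) ^+ 2); last first.
  by apply/funext => u; rewrite dotmul_axis.
by apply: is_derive_eq; rewrite /GRing.scale/= expr1 /cst; ring.
Qed.

(** The variable of the profile Y is ln (x . x) / 2, the logarithm of the
Euclidean norm: along a coordinate line x . x is a quadratic polynomial, so no
square root has to be differentiated. *)
Section RadialCalculus.
Context {R : realType} {n : nat}.
Variables (w : 'rV[R]_n -> R) (Y Y1 Y2 : R -> R).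
Hypothesis wE : forall x, punctured x -> w x = Y (ln (dotmul x x) / 2).
Hypothesis dY : forall t : R, is_derive t 1 Y (Y1 t).
Hypothesis dY1 : forall t : R, is_derive t 1 Y1 (Y2 t).

(* The formula for w, hence for its derivatives, holds only off the origin; the
   second derivative at x sees the first one along a whole segment around x. *)
Let near_punctured (x : 'rV[R]_n) (i : 'I_n) : punctured x ->
  \forall u \near (0 : R), punctured (x + u *: delta_mx 0 i).
Proof.
move=> x0; pose q (u : R) := dotmul (x + u *: delta_mx 0 i) (x + u *: delta_mx 0 i).
have qc : q u @[u --> 0] --> q 0.
  apply: differentiable_continuous; apply/derivable1_diffP.
  by have [] := is_derive_dotmul_axis x i 0.
have q0 : 0 < q 0 by rewrite /q scale0r addr0 dotmul_gt0.
near=> u; have : 0 < q u by near: u; exact: (cvgr_gt _ qc).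
rewrite /q /punctured /= => qu; apply: contraTneq qu => ->.
by rewrite /dotmul big1 ?ltxx// => j _; rewrite mxE mul0r.
Unshelve. all: by end_near. Qed.

Lemma partial_radial (x : 'rV[R]_n) (i : 'I_n) : punctured x ->
  partial i w x = Y1 (ln (dotmul x x) / 2) * (x 0 i / dotmul x x).
Proof.
move=> x0; have d0 := dotmul_gt0 x0.
suff : is_derive (x + 0 *: delta_mx 0 i) (delta_mx 0 i) w
    (Y1 (ln (dotmul x x) / 2) * (x 0 i / dotmul x x)).
  by rewrite scale0r addr0 => -[].
apply/is_derive_line.
pose q (u : R) := dotmul (x + u *: delta_mx 0 i) (x + u *: delta_mx 0 i).
have q0 : q 0 = dotmul x x by rewrite /q scale0r addr0.
apply: (near_eq_is_derive (f := Y \o (fun u => ln (q u) / 2))).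
  near=> u; rewrite /= wE//; near: u; exact: near_punctured.
have dq : is_derive (0 : R) 1 q (2 * (x 0 i + 0)) := is_derive_dotmul_axis x i 0.
have dl := is_derive_half_ln (ltac:(by rewrite q0) : 0 < q 0) dq.
have dYq := dY (ln (q 0) / 2).
apply: is_derive_eq; rewrite q0 addr0; field.
by rewrite gt_eqF.
Unshelve. all: by end_near. Qed.

Lemma partial2_radial (x : 'rV[R]_n) (i : 'I_n) : punctured x ->
  let d := dotmul x x in let t := ln d / 2 in
  partial i (partial i w) x =
    Y2 t * (x 0 i ^+ 2 / d ^+ 2) + Y1 t * (d - 2 * x 0 i ^+ 2) / d ^+ 2.
Proof.
move=> x0 d t; have d0 : 0 < d := dotmul_gt0 x0.
suff : is_derive (x + 0 *: delta_mx 0 i) (delta_mx 0 i) (partial i w)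
    (Y2 t * (x 0 i ^+ 2 / d ^+ 2) + Y1 t * (d - 2 * x 0 i ^+ 2) / d ^+ 2).
  by rewrite scale0r addr0 => -[].
apply/is_derive_line.
pose q (u : R) := dotmul (x + u *: delta_mx 0 i) (x + u *: delta_mx 0 i).
have q0 : q 0 = d by rewrite /q scale0r addr0.
have q0_neq0 : q 0 != 0 by rewrite q0 gt_eqF.
apply: (near_eq_is_derive (f := (Y1 \o (fun u => ln (q u) / 2)) *
    ((cst (x 0 i) + id) * (fun u => (q u)^-1)))).
  near=> u; rewrite partial_radial//; last by near: u; exact: near_punctured.
  by rewrite !fctE !mxE !eqxx/= mulr1.
have dq : is_derive (0 : R) 1 q (2 * (x 0 i + 0)) := is_derive_dotmul_axis x i 0.
have dl := is_derive_half_ln (ltac:(by rewrite q0) : 0 < q 0) dq.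
have dYq := dY1 (ln (q 0) / 2).
have dV := is_deriveV q0_neq0 dq.
apply: is_derive_eq; rewrite !fctE /GRing.scale/= /cst q0 !addr0 -/t; field.
by rewrite gt_eqF.
Unshelve. all: by end_near. Qed.

(** In the logarithmic variable the radial Laplacian r^(1-n) (r^(n-1) w')' has
constant coefficients, up to the factor r^2. *)
Lemma laplacian_radial (x : 'rV[R]_n) : punctured x ->
  let t := ln (dotmul x x) / 2 in
  laplacian w x = (Y2 t + (n%:R - 2) * Y1 t) / dotmul x x.
Proof.
move=> x0 t; have d0 := dotmul_gt0 x0.
have sumsq : \sum_i x 0 i ^+ 2 = dotmul x x by apply: eq_bigr => i _; rewrite expr2.
rewrite /laplacian (eq_bigr _ (fun i _ => partial2_radial i x0)) -/t.
rewrite big_split/= -mulr_sumr -mulr_suml sumsq -mulr_suml -mulr_sumr.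
rewrite sumrB sumr_const card_ord -mulr_sumr sumsq -mulr_natr; field.
by rewrite gt_eqF.
Qed.

(** The Euler operator x . grad is r d/dr = d/dt. *)
Lemma dotmul_grad_radial (x : 'rV[R]_n) : punctured x ->
  dotmul x (grad w x) = Y1 (ln (dotmul x x) / 2).
Proof.
move=> x0; have d0 := dotmul_gt0 x0; set t := ln _ / 2.
rewrite {1}/dotmul (eq_bigr (fun i => x 0 i * x 0 i * (Y1 t / dotmul x x))).
  by rewrite -mulr_suml -/(dotmul x x) mulrC divfK// gt_eqF.
by move=> i _; rewrite mxE partial_radial// -/t; ring.
Qed.

End RadialCalculus.

Section RadialProfile.
Context {R : realType} {n : nat}.
Variables (f : 'rV[R]_n -> R) (i0 : 'I_n).

(* The summand 0 presents the half-axis as a line through a base point. *)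
Let ray (u : R) : 'rV[R]_n := 0 + u *: delta_mx 0 i0.

Definition log_profile (t : R) : R := f (ray (expR t)).
Definition log_profile1 (t : R) : R := partial i0 f (ray (expR t)) * expR t.
Definition log_profile2 (t : R) : R :=
  partial i0 (partial i0 f) (ray (expR t)) * expR t ^+ 2 + log_profile1 t.

Lemma dotmul_ray (u : R) : dotmul (ray u) (ray u) = u ^+ 2.
Proof.
rewrite /ray dotmul_axis mxE mulr0 mul0r addr0 /dotmul big1 ?add0r// => i _.
by rewrite mxE mul0r.
Qed.

Lemma punctured_ray (t : R) : punctured (ray (expR t)).
Proof.
apply/eqP => r0; have := expR_gt0 t; have := dotmul_ray (expR t).
rewrite r0 /dotmul big1 => [/esym/eqP|i _]; last by rewrite mxE mul0r.
by rewrite sqrf_eq0 => /eqP ->; rewrite ltxx.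
Qed.

Lemma log_radius_ray (t : R) : ln (dotmul (ray (expR t)) (ray (expR t))) / 2 = t.
Proof. by rewrite dotmul_ray -expRM_natl expRK mulrC mulKf. Qed.

Lemma enorm_ray (t : R) : enorm (ray (expR t)) = expR t.
Proof. by rewrite /enorm dotmul_ray sqrtr_sqr gtr0_norm ?expR_gt0. Qed.

(** This is the only place where the symmetry of f is used: x is compared with
the point of the half-axis at the same distance from the origin. *)
Lemma radial_log_profile (x : 'rV[R]_n) : radially_symmetric f -> punctured x ->
  f x = log_profile (ln (dotmul x x) / 2).
Proof.
move=> frad x0; apply: frad => //; first exact: (punctured_ray _).
rewrite /enorm dotmul_ray -expRM_natl mulrC divfK ?lnK// posrE.
exact: dotmul_gt0.
Qed.

Lemma is_derive_along_ray (g : 'rV[R]_n -> R) (t : R) : C1_on punctured g ->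
  is_derive t 1 (fun t => g (ray (expR t))) (partial i0 g (ray (expR t)) * expR t).
Proof.
move=> gC1; have [dg _] := gC1 i0 _ (punctured_ray t).
have dline : is_derive (expR t) 1 (fun u => g (ray u)) (partial i0 g (ray (expR t))).
  by apply/is_derive_line; exact: derivableP.
exact: (@is_derive1_comp _ (fun u => g (ray u)) expR).
Qed.

Lemma is_derive_log_profile (t : R) : C2_on punctured f ->
  is_derive t 1 log_profile (log_profile1 t).
Proof. by move=> [fC1 _]; exact: is_derive_along_ray. Qed.

Lemma is_derive_log_profile1 (t : R) : C2_on punctured f ->
  is_derive t 1 log_profile1 (log_profile2 t).
Proof.
move=> [_ fC2]; have dp := is_derive_along_ray t (fC2 i0).
rewrite (_ : log_profile1 = (fun t => partial i0 f (ray (expR t))) * expR)//.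
by apply: is_derive_eq; rewrite /log_profile2 /log_profile1 /GRing.scale/=; ring.
Qed.

Lemma cvg_ray : ray (expR t) @[t --> -oo] --> (0 : 'rV[R]_n)^'.
Proof.
have expR0 : @expR R t @[t --> -oo] --> 0 by exact/cvgNy_compNP/cvgr_expR.
have ray0 : ray (expR t) @[t --> -oo] --> (0 : 'rV[R]_n).
  rewrite /ray -[X in _ --> X](addr0 0); apply: cvgD; first exact: cvg_cst.
  by rewrite -[X in _ --> X](scale0r (delta_mx 0 i0)); apply: cvgZr_tmp.
move=> A /ray0 rayA.
have {}rayA : \forall t \near -oo, ray (expR t) != 0 -> A (ray (expR t)) by [].
suff : \forall t \near -oo, A (ray (expR t)) by [].
by apply: filterS rayA => t /(_ (punctured_ray t)).
Qed.

End RadialProfile.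

(** * The rescaled equation *)

Lemma is_derive_expRM (R : realType) (c t F1 : R) (F : R -> R) :
  is_derive t 1 F F1 ->
  is_derive t 1 (fun u => expR (c * u) * F u) (expR (c * t) * (c * F t + F1)).
Proof.
move=> dF; rewrite (_ : (fun u => _) = (@expR R \o (c \*: id)) * F)//.
have dE : is_derive t 1 (@expR R \o (c \*: id)) (expR (c * t) * (c *: 1)).
  exact: is_derive1_comp.
by apply: is_derive_eq; rewrite /GRing.scale/= mulr1; ring.
Qed.

Lemma is_derive_powR_comp (R : realType) (a t G1 : R) (G : R -> R) :
  0 < G t -> is_derive t 1 G G1 ->
  is_derive t 1 (fun u => G u `^ a) (a * G t `^ (a - 1) * G1).
Proof.
move=> G0 dG; have dp := is_derive1_powR a G0.
exact: (@is_derive1_comp _ (fun x => x `^ a) G).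
Qed.

Lemma is_derive_powR_div (R : realType) (m t G1 : R) (G : R -> R) :
  0 < m -> 0 < G t -> is_derive t 1 G G1 ->
  is_derive t 1 (fun u => G u `^ m / m) (G t `^ (m - 1) * G1).
Proof.
move=> m0 G0 dG; rewrite (_ : (fun u => _) = m^-1 \*: (fun u => G u `^ m)).
  have dp := is_derive_powR_comp m G0 dG.
  apply: is_derive_eq; rewrite /GRing.scale/=; field.
  by rewrite gt_eqF.
by apply/funext => u; rewrite /= mulrC.
Qed.

Lemma cvg_powR (R : realType) (a l : R) (v : R -> R) : 0 < l ->
  v t @[t --> -oo] --> l -> v t `^ a @[t --> -oo] --> l `^ a.
Proof.
move=> l0 vl; have cpow : {for l, continuous (fun x : R => x `^ a)}.
  apply: differentiable_continuous.
  by apply/derivable1_diffP; have [] := is_derive1_powR a l0.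
exact: (continuous_cvg _ cpow vl).
Qed.

Lemma cvg_expRM_ninfty (R : realType) (k : R) : 0 < k ->
  expR (k * t) @[t --> -oo] --> 0.
Proof.
move=> k0; apply: (@cvg_comp _ _ _ (fun t => k * t) (@expR R) _ (@ninfty_nbhs R)).
  exact: gt0_cvgMrNy.
exact/cvgNy_compNP/cvgr_expR.
Qed.

(** G is the profile of f as a function of t = ln r, N the dimension and Y the
profile of f^m / m. The rescaled unknown is z = e^(c t) Y = v^m / m rather than
v: the second-order part of the equation is linear in Y, hence in z, whereas in
terms of v it would contain the square of v'. *)
Section ProfileExponent.
Context {R : realType}.
Variables (N m alpha beta gamma eta : R) (G G1 Y2 : R -> R).
Hypotheses (m0 : 0 < m) (eta0 : 0 < eta).
Hypothesis Gpos : forall t, 0 < G t.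
Hypothesis dG : forall t : R, is_derive t 1 G (G1 t).
Let Y (t : R) := G t `^ m / m.
Let Y1 (t : R) := G t `^ (m - 1) * G1 t.
Hypothesis dY1 : forall t : R, is_derive t 1 Y1 (Y2 t).
Hypothesis ode : forall t,
  Y2 t + (N - 2) * Y1 t + expR t ^+ 2 * (alpha * G t + beta * G1 t) = 0.
Let v (t : R) := expR (gamma * t) * G t.
Hypothesis vl : v t @[t --> -oo] --> eta.

Let c := gamma * m.
Let k := 2 - gamma * (1 - m).
Let z (t : R) := expR (c * t) * Y t.
Let z1 (t : R) := expR (c * t) * (c * Y t + Y1 t).
Let z2 (t : R) := expR (c * t) * (c * (c * Y t + Y1 t) + (c * Y1 t + Y2 t)).

Let dY (t : R) : is_derive t 1 Y (Y1 t) := is_derive_powR_div m0 (Gpos t) (dG t).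

Let dz (t : R) : is_derive t 1 z (z1 t).
Proof. exact: is_derive_expRM. Qed.

Let dz1 (t : R) : is_derive t 1 z1 (z2 t).
Proof.
have d : is_derive t 1 (c \*: Y + Y1) (c *: Y1 t + Y2 t).
  by have dYt := dY t; have dY1t := dY1 t; exact: is_deriveD.
exact: (is_derive_expRM c d).
Qed.

Let zE t : z t = v t `^ m / m.
Proof.
by rewrite /z /Y /v powRM ?expR_ge0 ?ltW// mulrA -expRM [gamma * t * m]mulrAC.
Qed.

(** This is e^(c t) times the equation for Y. The first derivative of G is
eliminated through G' = G^(1-m) Y', and the powers of e^t combine to e^(k t)
because k = 2 - gamma + c. *)
Lemma rescaled_ode t :
  z2 t + (N - 2 - 2 * c) * z1 t + c * (c - (N - 2)) * z t +
  expR (k * t) * ((alpha - beta * gamma) * v t + beta * v t `^ (1 - m) * z1 t) = 0.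
Proof.
have G0 := Gpos t; have Gn0 : G t != 0 by rewrite gt_eqF.
set W := G t `^ m; set V := G t `^ (1 - m).
have GE : G t = V * W by rewrite -powRD ?Gn0 ?implybT// subrK powRr1// ltW.
have G1E : G1 t = V * Y1 t.
  by rewrite /Y1 mulrA -powRD ?Gn0 ?implybT// addrC subrKA subrr powRr0 mul1r.
have vE : v t `^ (1 - m) = expR (gamma * (1 - m) * t) * V.
  by rewrite powRM ?expR_ge0 ?ltW// -expRM mulrAC.
have KQ : expR (k * t) * expR (gamma * (1 - m) * t) = expR t ^+ 2.
  by rewrite -expRD -expRM_natl; congr expR; rewrite /k; ring.
have KE : expR (k * t) * expR (gamma * t) = expR (c * t) * expR t ^+ 2.
  by rewrite -expRM_natl -!expRD; congr expR; rewrite /k /c; ring.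
have YE : m * Y t = W by rewrite /Y mulrC divfK ?gt_eqF.
have := ode t; rewrite vE /z2 /z1 /z /v G1E GE -YE.
move: KQ KE; set K := expR (k * t); set P := expR (c * t).
set Q := expR (gamma * (1 - m) * t); set E := expR t; set B := expR (gamma * t).
move=> KQ KE odet.
(* The claim minus P times the equation is rem, a combination of the two
   exponent identities KE and KQ. *)
pose rem := (alpha - beta * gamma) * (V * (m * Y t)) * (K * B - P * E ^+ 2)
  + beta * V * P * (c * Y t + Y1 t) * (K * Q - E ^+ 2).
have rem0 : rem = 0 by rewrite /rem KQ KE !subrr !mulr0 addr0.
rewrite -[RHS](addr0 0) -{1}rem0 -[X in _ = _ + X](mulr0 P) -odet /rem /c; ring.
Qed.

Let zl : z t @[t --> -oo] --> eta `^ m / m.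
Proof.
rewrite (_ : z = (fun t => v t `^ m / m)); last by apply/funext => t; exact: zE.
by apply: cvgMr_tmp; exact: cvg_powR.
Qed.

(** Here e^(k t) tends to 0, so the limit of the zero-order terms comes from the
second-order operator alone. *)
Lemma diffusion_dominated : 0 < k -> c * (c - (N - 2)) = 0.
Proof.
move=> k0; have Kl := cvg_expRM_ninfty k0.
have ql : N - 2 - 2 * c + expR (k * t) * (beta * v t `^ (1 - m)) @[t --> -oo] -->
    N - 2 - 2 * c + 0 * (beta * eta `^ (1 - m)).
  apply: cvgD; first exact: cvg_cst.
  by apply: cvgM => //; apply: cvgMl_tmp; exact: cvg_powR.
have sl : c * (c - (N - 2)) * z t + expR (k * t) * ((alpha - beta * gamma) * v t)
    @[t --> -oo] -->
    c * (c - (N - 2)) * (eta `^ m / m) + 0 * ((alpha - beta * gamma) * eta).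
  apply: cvgD; first exact: cvgMl_tmp.
  by apply: cvgM => //; exact: cvgMl_tmp.
have ode1 t : 1 * z2 t
    + (N - 2 - 2 * c + expR (k * t) * (beta * v t `^ (1 - m))) * z1 t
    + (c * (c - (N - 2)) * z t + expR (k * t) * ((alpha - beta * gamma) * v t)) = 0.
  by rewrite -[RHS](rescaled_ode t); ring.
have pl : (1 : R) @[_ --> (-oo : set_system R)] --> (1 : R) by exact: cvg_cst.
have := limit_zero_order_term dz dz1 (fun=> ler01) ode1 zl pl ql sl.
rewrite mul0r addr0 => /eqP.
by rewrite mulf_eq0 [X in _ || X]gt_eqF ?orbF ?divr_gt0 ?powR_gt0// => /eqP.
Qed.

(** After multiplication by e^(-k t) the coefficient of z'' tends to 0, and the
zero-order terms tend to (alpha - beta gamma) eta. *)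
Lemma transport_dominated : k < 0 -> alpha = beta * gamma.
Proof.
rewrite -oppr_gt0 => k0; have Kl := cvg_expRM_ninfty k0.
have ql : expR (- k * t) * (N - 2 - 2 * c) + beta * v t `^ (1 - m) @[t --> -oo] -->
    0 * (N - 2 - 2 * c) + beta * eta `^ (1 - m).
  by apply: cvgD; [exact: cvgMr_tmp | apply: cvgMl_tmp; exact: cvg_powR].
have sl : expR (- k * t) * (c * (c - (N - 2)) * z t) + (alpha - beta * gamma) * v t
    @[t --> -oo] -->
    0 * (c * (c - (N - 2)) * (eta `^ m / m)) + (alpha - beta * gamma) * eta.
  by apply: cvgD; [apply: cvgM => // | ]; exact: cvgMl_tmp.
have KN t : expR (- k * t) * expR (k * t) = 1.
  by rewrite mulNr expRN mulVf// gt_eqF ?expR_gt0.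
have odeK t : expR (- k * t) * z2 t
    + (expR (- k * t) * (N - 2 - 2 * c) + beta * v t `^ (1 - m)) * z1 t
    + (expR (- k * t) * (c * (c - (N - 2)) * z t) + (alpha - beta * gamma) * v t) = 0.
  rewrite -[RHS](mulr0 (expR (- k * t))) -(rescaled_ode t) !mulrDr.
  rewrite [X in _ = _ + (X + _)]mulrA [X in _ = _ + (_ + X)]mulrA KN !mul1r; ring.
have := limit_zero_order_term dz dz1 (fun t => expR_ge0 (- k * t)) odeK zl Kl ql sl.
rewrite mul0r add0r => /eqP; rewrite mulf_eq0 [X in _ || X]gt_eqF// orbF subr_eq0.
by move/eqP.
Qed.

End ProfileExponent.

(** * The admissible exponents *)

Theorem theorem1p3 (R : realType) (n : nat) (m alpha beta gamma eta : R)
    (hn : (3 <= n)%N)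
    (hm0 : 0 < m) (hm : m < (n%:R - 2) / n%:R)
    (hgamma : 0 < gamma) (hgamma_ne : gamma != 2 / (1 - m))
    (heta : 0 < eta)
    (hf : exists f : 'rV[R]_n -> R,
        [/\ solution m alpha beta f,
            radially_symmetric f
          & enorm x `^ gamma * f x @[x --> (0 : 'rV[R]_n)^'] --> eta]) :
  (alpha = 0 /\ beta = 0) \/
  (beta != 0 /\ gamma = alpha / beta /\ gamma > 2 / (1 - m)).
Proof.
have [f [[fC2 fpos feq] frad flim]] := hf.
have n0 : (0 < n)%N by exact: leq_trans hn.
have nR : 0 < n%:R :> R by rewrite ltr0n.
have hmn : m * n%:R < n%:R - 2 by rewrite -ltr_pdivlMr.
have m1 : 0 < 1 - m.
  by rewrite subr_gt0 (lt_trans hm)// ltr_pdivrMr// mul1r; lra.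
pose i0 := Ordinal n0.
pose G := log_profile f i0; pose G1 := log_profile1 f i0.
pose G2 := log_profile2 f i0.
have dG (t : R) : is_derive t 1 G (G1 t) := is_derive_log_profile i0 t fC2.
have dG1 (t : R) : is_derive t 1 G1 (G2 t) := is_derive_log_profile1 i0 t fC2.
have Gpos t : 0 < G t by apply: fpos; exact: (punctured_ray i0 t).
have fG x : punctured x -> f x = G (ln (dotmul x x) / 2).
  exact: radial_log_profile.
pose Y t := G t `^ m / m; pose Y1 t := G t `^ (m - 1) * G1 t.
pose Y2 t := G t `^ (m - 1) * G2 t + G1 t * ((m - 1) * G t `^ (m - 1 - 1) * G1 t).
have dY (t : R) : is_derive t 1 Y (Y1 t) := is_derive_powR_div hm0 (Gpos t) (dG t).
have dY1 (t : R) : is_derive t 1 Y1 (Y2 t).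
  have dp := is_derive_powR_comp (m - 1) (Gpos t) (dG t).
  exact: (is_deriveM dp (dG1 t)).
have ode t : Y2 t + (n%:R - 2) * Y1 t
    + expR t ^+ 2 * (alpha * G t + beta * G1 t) = 0.
  have r0 := punctured_ray i0 t.
  have := feq _ r0; rewrite (dotmul_grad_radial fG dG r0) (fG _ r0).
  have wY x : punctured x -> f x `^ m / m = Y (ln (dotmul x x) / 2).
    by move=> x0; rewrite fG.
  rewrite (laplacian_radial wY dY dY1 r0) log_radius_ray dotmul_ray => E.
  rewrite -[RHS](mulr0 (expR t ^+ 2)) -E; field.
  by rewrite gt_eqF ?expR_gt0.
have vl : expR (gamma * t) * G t @[t --> -oo] --> eta.
  have := cvg_comp _ _ (@cvg_ray R n i0) flim.
  apply: cvg_trans; apply: near_eq_cvg; near=> t.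
  by rewrite /= enorm_ray -expRM [t * gamma]mulrC.
have [k0|k0|k0] := ltgtP (2 - gamma * (1 - m)) 0.
- have ab := transport_dominated hm0 heta Gpos dG dY1 ode vl k0.
  have [b0|b0] := eqVneq beta 0; first by left; rewrite ab b0 mul0r.
  right; split=> //; split; first by rewrite ab mulrC mulKf.
  by rewrite ltr_pdivrMr//; lra.
- have := diffusion_dominated hm0 heta Gpos dG dY1 ode vl k0.
  move/eqP; rewrite !mulf_eq0 (gt_eqF hgamma) (gt_eqF hm0)/= subr_eq0 => /eqP c0.
  (* Here gamma < n, whereas gamma * m = n - 2 and m * n < n - 2. *)
  have : gamma < n%:R by lra.
  by rewrite -(ltr_pM2r hm0) c0 [_ * m]mulrC => /(lt_trans hmn); rewrite ltxx.
- case/eqP: hgamma_ne; apply: (mulIf (lt0r_neq0 m1)).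
  by rewrite divfK ?lt0r_neq0//; lra.
Unshelve. all: by end_near. Qed.
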